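(* Let $X$ be a complex Banach space with a $1$-unconditional Schauder basis $(e_j)_{j\ge1}$. Then the family $\{K_\eta:\eta\in c_0^+(\mathbb N_0)\}$ is a fundamental system of compact, absolutely convex, solid subsets of $X$ (that is, every $K_\eta$ is compact, absolutely convex and solid, and every compact subset of $X$ is contained in some $K_\eta$). Moreover, for every $\eta\in c_0^+(\mathbb N_0)$ and every $r>0$, $$rK_\eta=K_{r\eta}.$$
   Context: A Schauder basis $(e_j)$ of $X$ is $1$-unconditional if $\|\sum_j\lambda_jx_je_j\|\le\|\sum_jx_je_j\|$ whenever $\sum_j x_je_j\in X$ and $|\lambda_j|\le1$ for all $j$. A set $A\subset X$ is solid (with respect to $(e_j)$) if $x=\sum_jx_je_j\in A$, $y=\sum_jy_je_j\in X$ and $|y_j|\le|x_j|$ for all $j$ imply $y\in A$. Let $(e_j^* )$ be the coefficient functionals, $\pi_Nx=\sum_{j=1}^Ne_j^*(x)e_j$ for $N\in\mathbb N$, and $\pi_0=0$. Let $c_0^+(\mathbb N_0)$ be the set of sequences $\eta=(\eta_N)_{N\ge0}$ with $\eta_N>0$ for every $N$ and $\eta_N\to0$. For $\eta\in c_0^+(\mathbb N_0)$, $$K_\eta=\{x\in X:\|(\operatorname{Id}-\pi_N)x\|\le\eta_N\text{ for every }N\in\mathbb N_0\}.$$ *)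

(* Defs.v *)
From mathcomp Require Import all_boot all_order all_algebra.
From mathcomp Require Import all_classical all_reals topology normedtype sequences.
From mathcomp Require Export complex.

Set Implicit Arguments.
Unset Strict Implicit.
Unset Printing Implicit Defensive.

Import Order.TTheory GRing.Theory Num.Theory numFieldNormedType.Exports.

Local Open Scope classical_set_scope.
Local Open Scope ring_scope.
Local Open Scope complex_scope.

(* Basis vectors are indexed from 0: [e j] stands for the mathematical
   $e_{j+1}$. *)
Section Basis.
Variables (R : realType) (X : normedModType R[i]).
Implicit Types (e : nat -> X) (a l : nat -> R[i]) (x y : X) (A : set X).

Definition expands e a x : Prop := series (fun j => a j *: e j) @ \oo --> x.

Definition schauder_basis e : Prop := forall x, exists! a, expands e a x.

(* The coefficient functionals: [coef e x j] is $e_{j+1}^*(x)$.  The default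
   value of [xget] is never used when [e] is a Schauder basis. *)
Definition coef e x : nat -> R[i] := xget (fun=> 0) [set a | expands e a x].

(* The convergence of the multiplied series, which is implicit in writing its
   norm, is required here explicitly because [limn] is total. *)
Definition unconditional1 e : Prop :=
  forall a l, cvgn (series (fun j => a j *: e j)) ->
    (forall j, `|l j| <= 1) ->
    cvgn (series (fun j => (l j * a j) *: e j)) /\
    `|limn (series (fun j => (l j * a j) *: e j))|
      <= `|limn (series (fun j => a j *: e j))|.

Definition solid e A : Prop :=
  forall x y, A x -> (forall j, `|coef e y j| <= `|coef e x j|) -> A y.

Definition absolutely_convex A : Prop :=
  forall x y (s t : R[i]), A x -> A y -> `|s| + `|t| <= 1 ->
    A (s *: x + t *: y).

Definition basis_proj e (N : nat) x : X := \sum_(j < N) coef e x j *: e j.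

Definition c0_pos : set (nat -> R) :=
  [set eta | (forall N, 0 < eta N) /\ eta @ \oo --> (0 : R)].

(* The norm of [X] takes its values in [R[i]], whence the embedding of the
   real bound [eta N]. *)
Definition K_ e (eta : nat -> R) : set X :=
  [set x | forall N, `|x - basis_proj e N x| <= (eta N)%:C].

End Basis.

Arguments c0_pos : clear implicits.

(* Main.v *)
Require Import Defs.
From mathcomp Require Import all_boot all_order all_algebra.
From mathcomp Require Import all_classical all_reals topology normedtype sequences.

Set Implicit Arguments.
Unset Strict Implicit.
Unset Printing Implicit Defensive.

Import Order.TTheory GRing.Theory Num.Theory numFieldNormedType.Exports.
Local Open Scope classical_set_scope.
Local Open Scope ring_scope.
Local Open Scope complex_scope.

(** The norm estimates rest on one consequence of 1-unconditionality:
    domination of the coefficients implies domination of the norms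
    ([norm_le_coef]), because if |y_j| <= |x_j| for all j, then the quotients
    y_j / x_j are admissible multipliers. Passing to the tail x - pi_N x
    replaces the first N coefficients by 0, so solidity of K_eta is this fact
    applied to tails; the maps Id - pi_N are contractions ([tail_norm_le]), and
    the k-th coefficient functional has norm at most 1 / |e_k|
    ([coef_norm_le]). As the tails are linear in x, absolute convexity and the
    identity r K_eta = K_(r eta) follow from the properties of the norm.

    Compactness of K_eta is proved with ultrafilters rather than through total
    boundedness. Let U be an ultrafilter containing K_eta. Each coefficient is
    bounded on K_eta, hence converges along U to some c_k by Bolzano-Weierstrass
    in the complex plane, and so pi_N x converges along U to
    p_N = sum_(j < N) c_j e_j. Since |x - pi_N x| <= eta_N on K_eta, the
    ultrafilter contains balls around p_N of radius slightly above eta_N; as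
    eta_N tends to 0, U is Cauchy. Its limit lies in K_eta because the
    contractions Id - pi_N are continuous.

    Conversely, let A be compact. The tails tend to 0 pointwise and are
    equicontinuous, hence tend to 0 uniformly on A, and eta_N is the supremum
    over A of the norm of the N-th tail, increased by 1 / (N + 1) to make it
    positive. *)

(** * Complex-valued norms *)

Section ComplexNorm.
Variables (R : realType) (X : normedModType R[i]).

(** The norm of [X] has its values in [R[i]], while suprema and the bounds
    [eta] live in [R]. *)
Definition rnorm (x : X) : R := complex.Re `|x|.

Lemma rnormE x : `|x| = (rnorm x)%:C.
Proof. by rewrite RRe_real// normr_real. Qed.

Lemma rnorm_ge0 x : 0 <= rnorm x.
Proof. by rewrite -ler0c -rnormE. Qed.

Lemma gt0_complexE (c : R[i]) : 0 < c -> c = (complex.Re c)%:C /\ 0 < complex.Re c.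
Proof.
move=> c0; have cE : c = (complex.Re c)%:C by rewrite RRe_real ?gtr0_real.
by split=> //; rewrite -ltcR -cE.
Qed.

End ComplexNorm.

(** * Ultrafilters and bounded complex functions *)

Lemma norm_le_ReIm (R : realType) (z : R[i]) :
  `|z| <= (`|complex.Re z| + `|complex.Im z|)%:C.
Proof.
rewrite {1}[z]complexE (le_trans (ler_normD _ _))// normrM.
have -> : `|'i%C : R[i]| = 1 by rewrite normc_def /= expr0n expr1n add0r sqrtr1.
by rewrite mul1r !normc_def /= !expr0n/= !addr0 !sqrtr_sqr -rmorphD.
Qed.

Lemma ReIm_le_norm (R : realType) (z : R[i]) (r : R) : `|z| <= r%:C ->
  `|complex.Re z| <= r /\ `|complex.Im z| <= r.
Proof.
rewrite normc_def lecR => zr.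
split; apply: le_trans zr; rewrite -sqrtr_sqr ler_sqrt ?addr_ge0 ?sqr_ge0//.
  by rewrite lerDl sqr_ge0.
by rewrite lerDr sqr_ge0.
Qed.

Lemma ultra_fmap (S T : Type) (f : S -> T) (U : set_system S) :
  UltraFilter U -> UltraFilter (f @ U).
Proof.
move=> UU; split; first exact: fmap_proper_filter.
move=> G PG fUG; apply/seteqP; split; last exact: fUG.
move=> A GA; have [//|UnA] := in_ultra_setVsetC (f @^-1` A) UU.
have /fUG GnA : (f @ U) (~` A) by [].
by have [] := @filter_not_empty _ G _; rewrite -(setICr A); apply: filterI.
Qed.

(** Bolzano-Weierstrass along an ultrafilter: the real and the imaginary part
    are ultrafilter limits in the compact segment [-r, r]. *)
Lemma ultra_bounded_cvg (R : realType) (T : Type) (U : set_system T)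
    (f : T -> R[i]) (r : R) :
  UltraFilter U -> U [set t | `|f t| <= r%:C] ->
  exists c : R[i], f t @[t --> U] --> (c : R[i]^o).
Proof.
move=> UU Ur.
have Ucpt (g : R[i] -> R) : (forall z : R[i], `|z| <= r%:C -> `|g z| <= r) ->
    exists a : R, g (f t) @[t --> U] --> a.
  move=> gr; have := @segment_compact R (- r) r; rewrite compact_ultra.
  move=> /(_ _ (@ultra_fmap _ _ (g \o f) U UU)) [].
  - by apply: (@filterS _ U) Ur => t /gr; rewrite /= in_itv ler_norml.
  - by move=> a [_ ga]; exists a.
have [z|a Ua] := Ucpt (@complex.Re R); first by case/ReIm_le_norm.
have [z|b Ub] := Ucpt (@complex.Im R); first by case/ReIm_le_norm.
exists (a +i* b)%C; apply/(@cvgrPdist_le R[i] R[i]^o) => /= d /gt0_complexE[-> d0].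
have d20 : 0 < complex.Re d / 2 by rewrite divr_gt0.
move/cvgrPdist_le/(_ _ d20): Ua => Ua.
move/cvgrPdist_le/(_ _ d20): Ub => Ub.
apply: filterS2 Ua Ub => t /=; case: (f t) => x y /= ax bx.
apply: le_trans (norm_le_ReIm _) _.
by rewrite lecR [leRHS]splitr lerD.
Qed.

(** * Coefficients and tails of a Schauder basis *)

Section SchauderBasis.
Variables (R : realType) (X : normedModType R[i]) (e : nat -> X).
Hypothesis he : schauder_basis e.
Implicit Types (x y z : X) (a b : nat -> R[i]) (N : nat).

Lemma expands_coef x : expands e (coef e x) x.
Proof.
have [a [ax _]] := he x.
exact: (@xgetI _ (fun=> 0) [set a | expands e a x] a ax).
Qed.

Lemma coef_unique a x : expands e a x -> coef e x = a.
Proof.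
move=> ax; have [b [_ bE]] := he x.
by rewrite -(bE _ ax); symmetry; apply: bE; exact: expands_coef.
Qed.

Lemma expands_lin s t a b x y : expands e a x -> expands e b y ->
  expands e (fun j => s * a j + t * b j) (s *: x + t *: y).
Proof.
rewrite /expands => ax bY.
rewrite (_ : series _ =
  (fun n => s *: series (fun j => a j *: e j) n + t *: series (fun j => b j *: e j) n)).
  by apply: cvgD; apply: cvgZl_tmp.
apply/funext => n; rewrite /series/= !scaler_sumr -big_split/=.
by apply: eq_bigr => j _; rewrite scalerDl !scalerA.
Qed.

Lemma coef_lin s t x y j :
  coef e (s *: x + t *: y) j = s * coef e x j + t * coef e y j.
Proof.
by have /coef_unique -> := @expands_lin s t _ _ _ _ (@expands_coef x) (@expands_coef y).
Qed.

Lemma expands_finite a N : (forall j, (N <= j)%N -> a j = 0) ->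
  expands e a (\sum_(j < N) a j *: e j).
Proof.
move=> a0; apply: cvg_near_cst; near=> n.
have Nn : (N <= n)%N by near: n; exact: nbhs_infty_ge.
rewrite /series/= (big_cat_nat (leq0n N) Nn)//= [X in _ + X]big_nat_cond.
rewrite [X in _ + X]big1 ?addr0 ?big_mkord// => j /andP[/andP[Nj _] _].
by rewrite a0 ?scale0r.
Unshelve. all: by end_near. Qed.

Lemma coef_proj N x j :
  coef e (basis_proj e N x) j = if (j < N)%N then coef e x j else 0.
Proof.
have := @expands_finite (fun j => if (j < N)%N then coef e x j else 0) N.
under eq_bigr do rewrite ltn_ord.
by rewrite -/(basis_proj _ _ _) => /(_ _)/coef_unique -> // i; case: ltnP.
Qed.

Lemma coef_tail N x j :
  coef e (x - basis_proj e N x) j = if (j < N)%N then 0 else coef e x j.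
Proof.
have := coef_lin 1 (-1) x (basis_proj e N x) j.
rewrite scale1r scaleN1r mul1r mulN1r => ->; rewrite coef_proj.
by case: ifP; rewrite ?subrr ?subr0.
Qed.

Lemma basis_proj_lin N s t x y :
  basis_proj e N (s *: x + t *: y) = s *: basis_proj e N x + t *: basis_proj e N y.
Proof.
rewrite /basis_proj !scaler_sumr -big_split/=.
by apply: eq_bigr => j _; rewrite coef_lin scalerDl !scalerA.
Qed.

Lemma tail_lin N s t x y :
  (s *: x + t *: y) - basis_proj e N (s *: x + t *: y) =
  s *: (x - basis_proj e N x) + t *: (y - basis_proj e N y).
Proof. by rewrite basis_proj_lin !scalerBr opprD addrACA. Qed.

Lemma tailB N x y :
  (x - y) - basis_proj e N (x - y) = (x - basis_proj e N x) - (y - basis_proj e N y).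
Proof. by have := tail_lin N 1 (-1) x y; rewrite !scale1r !scaleN1r. Qed.

Lemma tail_cvg0 x : (x - basis_proj e N x) @[N --> \oo] --> (0 : X).
Proof.
rewrite -(subrr x); apply: cvgB; first exact: cvg_cst.
rewrite (_ : (basis_proj e)^~ x = series (fun j => coef e x j *: e j)).
  exact: expands_coef.
by apply/funext => n; rewrite /series/= big_mkord.
Qed.

(** If [e k] vanished, the zero vector would have two expansions: the zero
    sequence and the k-th unit sequence. *)
Lemma basis_neq0 k : e k != 0.
Proof.
apply/eqP => ek0; pose d j : R[i] := (j == k)%:R.
have s0 a : (forall j, a j *: e j = 0) -> expands e a 0.
  move=> ae0; apply: cvg_near_cst; near=> n.
  by rewrite /series/= big1.
have /coef_unique d0 : expands e d 0.
  by apply: s0 => j; rewrite /d; case: eqP => [->|_]; rewrite ?ek0 ?scaler0 ?scale0r.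
have /coef_unique z0 : expands e (fun=> 0) 0 by apply: s0 => j; rewrite scale0r.
have := congr1 (@^~ k) z0; rewrite d0 /d eqxx => /eqP; by rewrite oner_eq0.
Unshelve. all: by end_near. Qed.

(** * Norm estimates from unconditionality *)

Section Unconditional.
Hypothesis hu : unconditional1 e.

(** The vector [y] is obtained from [x] by the multipliers
    [coef e y j / coef e x j], of modulus at most 1. *)
Lemma norm_le_coef x y :
  (forall j, `|coef e y j| <= `|coef e x j|) -> `|y| <= `|x|.
Proof.
move=> yx; pose l j := coef e y j / coef e x j.
have ly : (fun j => (l j * coef e x j) *: e j) = (fun j => coef e y j *: e j).
  apply/funext => j; congr (_ *: _); rewrite /l.
  (* where x_j = 0 the quotient is 0, and the domination forces y_j = 0 *)
  have [x0|x0] := eqVneq (coef e x j) 0; last by rewrite divfK.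
  apply/esym/eqP; rewrite x0 mulr0 -normr_le0.
  by have := yx j; rewrite x0 normr0.
have limE z : limn (series (fun j => coef e z j *: e j)) = z.
  by apply: cvg_lim; [exact: norm_hausdorff|exact: expands_coef].
have cx : cvgn (series (fun j => coef e x j *: e j)).
  by apply/cvg_ex; exists x; exact: expands_coef.
have [j|_] := hu (l := l) cx.
  rewrite normrM normfV.
  have [x0|x0] := eqVneq (coef e x j) 0; first by rewrite x0 normr0 invr0 mulr0.
  by rewrite ler_pdivrMr ?normr_gt0// mul1r.
by rewrite ly !limE.
Qed.

Lemma tail_norm_le N x : `|x - basis_proj e N x| <= `|x|.
Proof. by apply: norm_le_coef => j; rewrite coef_tail; case: ifP; rewrite ?normr0. Qed.

(** The vector [coef e x k *: e k] keeps only the k-th coefficient of [x]. *)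
Lemma coef_norm_le x k : `|coef e x k| * `|e k| <= `|x|.
Proof.
pose a j := if (j == k)%N then coef e x k else 0.
have ak : expands e a (coef e x k *: e k).
  rewrite (_ : _ *: _ = \sum_(j < k.+1) a j *: e j).
    by apply: expands_finite => j kj; rewrite /a gtn_eqF.
  rewrite big_ord_recr/= big1 ?add0r => [|i _]; first by rewrite /a eqxx.
  by rewrite /a ltn_eqF ?scale0r.
rewrite -normrZ; apply: norm_le_coef => j; rewrite (coef_unique ak).
by rewrite /a; case: eqP => [->|_]; rewrite ?normr0.
Qed.

End Unconditional.
End SchauderBasis.

(** * The sets K_eta *)

Section Compacta.
Variables (R : realType) (X : completeNormedModType R[i]) (e : nat -> X).
Hypotheses (he : schauder_basis e) (hu : unconditional1 e).
Implicit Types (eta : nat -> R) (x y : X).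

Lemma K_solid eta : solid e (K_ e eta).
Proof.
move=> x y Kx yx N; apply: le_trans (Kx N).
by apply: norm_le_coef => // j; rewrite !coef_tail//; case: ifP.
Qed.

Lemma K_absolutely_convex eta : (forall N, 0 <= eta N) ->
  absolutely_convex (K_ e eta).
Proof.
move=> eta0 x y s t Kx Ky st N; rewrite tail_lin// (le_trans (ler_normD _ _))//.
rewrite !normrZ (@le_trans _ _ ((`|s| + `|t|) * (eta N)%:C))//.
  by rewrite mulrDl lerD// ler_wpM2l.
by rewrite ler_piMl// ler0c.
Qed.

Lemma K_scale eta (r : R) : 0 < r ->
  [set r%:C *: x | x in K_ e eta] = K_ e (fun N => r * eta N).
Proof.
move=> r0; have rC0 : 0 < r%:C :> R[i] by rewrite ltcR.
have tailZ N (c : R[i]) x : c *: x - basis_proj e N (c *: x) =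
    c *: (x - basis_proj e N x).
  by have := tail_lin he N c 0 x x; rewrite !scale0r !addr0.
apply/seteqP; split=> [_ [x Kx <-] N|x Kx].
  by rewrite tailZ normrZ gtr0_norm// rmorphM ler_pM2l.
exists (r%:C^-1 *: x); last by rewrite scalerA divff ?scale1r ?gt_eqF.
move=> N; rewrite tailZ normrZ gtr0_norm ?invr_gt0//.
by rewrite ler_pdivrMl// -rmorphM; exact: Kx.
Qed.

(** A filter form of closedness: [x - basis_proj e N x] depends continuously
    on [x], because [Id - pi_N] is a linear contraction. *)
Lemma K_closed eta (U : set_system X) z : ProperFilter U ->
  U (K_ e eta) -> U --> z -> K_ e eta z.
Proof.
move=> PU UK /cvgrPdist_le Uz N; rewrite rnormE lecR.
apply/ler_addgt0Pr => d d0; rewrite -lecR -rnormE rmorphD.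
have dC0 : 0 < d%:C :> R[i] by rewrite ltcR.
have [x [Kx /= zx]] := filter_ex (filterI UK (Uz _ dC0)).
rewrite -(subrK (x - basis_proj e N x) (z - _)) -tailB// addrC.
by rewrite (le_trans (ler_normD _ _))// lerD// (le_trans (tail_norm_le he hu _ _)).
Qed.

(** Along an ultrafilter on [K_ e eta] all coefficients converge, and the
    uniform smallness of the tails turns this coordinatewise convergence into
    the Cauchy property. *)
Lemma K_compact eta : c0_pos R eta -> compact (K_ e eta).
Proof.
move=> [eta0 etac]; rewrite compact_ultra => U UU UK.
have Uc k : exists c : R[i], coef e x k @[x --> U] --> (c : R[i]^o).
  apply: (@ultra_bounded_cvg _ _ _ _ (eta 0 / rnorm (e k))).
  (* the condition for N = 0 says that the norm of x is at most eta 0 *)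
  apply: filterS UK => x /(_ 0).
  rewrite /basis_proj big_ord0 subr0 => xeta /=.
  rewrite rmorphM fmorphV /= -rnormE ler_pdivlMr ?normr_gt0 ?basis_neq0//.
  by rewrite (le_trans (coef_norm_le he hu _ _)).
have /choice[c cP] := Uc.
have Uproj N : basis_proj e N x @[x --> U] --> \sum_(j < N) c j *: e j.
  apply: cvg_big => [|j _]; first exact: add_continuous.
  by apply: cvgZr_tmp; exact: cP.
have /cauchy_cvgP : cauchy U.
  apply/cauchyP => /= d /gt0_complexE[-> d0].
  have d20 : 0 < complex.Re d / 2 by rewrite divr_gt0.
  have [N /= etaN] : exists N, eta N < complex.Re d / 2.
    by apply: (@filter_ex _ \oo); exact: cvgr_lt etac _ d20.
  exists (\sum_(j < N) c j *: e j).
  have /cvgrPdist_le/(_ (complex.Re d / 2)%:C) := Uproj N.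
  rewrite ltcR d20 => /(_ isT); apply: filterS2 UK => x Kx xc.
  rewrite -ball_normE/= -(subrKA (basis_proj e N x)) (le_lt_trans (ler_normD _ _))//.
  rewrite (splitr (complex.Re d)) rmorphD ler_ltD//.
  by rewrite distrC (le_lt_trans (Kx N))// ltcR.
move=> /cvg_ex[z Uz]; exists z; split=> //; exact: K_closed Uz.
Qed.

(** Pointwise convergence of the tails to 0 is uniform on [A], by a covering
    argument: near [x], the tail of [x'] is the tail of [x] plus the tail of
    [x' - x], and the latter is bounded by the norm of [x' - x]. *)
Lemma compact_sub_K A : compact A -> exists2 eta, c0_pos R eta & A `<=` K_ e eta.
Proof.
move=> /compact_near_coveringP cA.
pose q N x := rnorm (x - basis_proj e N x).
have qle d : 0 < d -> \forall N \near \oo, forall x, A x -> q N x <= d.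
  move=> d0; have := cA nat \oo (fun N x => q N x <= d) _; apply => x Ax.
  have d20 : 0 < (d / 2)%:C :> R[i] by rewrite ltcR divr_gt0.
  near=> x' N => /=; rewrite -lecR -rnormE.
  rewrite -(subrK (x - basis_proj e N x) (x' - _)) -tailB//.
  rewrite (le_trans (ler_normD _ _))// (splitr d) rmorphD/= lerD//.
    by rewrite (le_trans (tail_norm_le he hu _ _)).
  by near: N; exact: (cvgr0_norm_le _ (@tail_cvg0 _ _ _ he x)).
have [M AM] : exists M : nat, forall x, A x -> rnorm x <= M%:R.
  apply: (@filter_ex _ \oo).
  have := cA nat \oo (fun N x => rnorm x <= N%:R) _; apply => x Ax.
  near=> x' N => /=; apply: (@le_trans _ _ (1 + rnorm x)).
    rewrite -lecR rmorphD rmorph1 -!rnormE -{1}(subrK x x') (le_trans (ler_normD _ _))//.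
    by rewrite lerD//= -rnormE.
  by near: N; exact: nbhs_infty_ger.
have qsup N : has_ubound [set q N x | x in A].
  exists M%:R => _ [x Ax <-]; rewrite (le_trans _ (AM _ Ax))//.
  by rewrite -lecR -!rnormE tail_norm_le.
pose eta N := sup [set q N x | x in A] + harmonic N.
exists eta; last first.
  move=> x Ax N; rewrite rnormE lecR (@le_trans _ _ (sup [set q N x | x in A]))//.
    by apply: ub_le_sup => //; exists x.
  by rewrite lerDl ltW ?harmonic_gt0.
have sup_ge0 N : 0 <= sup [set q N x | x in A].
  (* the supremum of the empty set is 0 *)
  have [->|/set0P[x Ax]] := eqVneq A set0; first by rewrite image_set0 sup0.
  by apply: (@le_trans _ _ (q N x)); [exact: rnorm_ge0|apply: ub_le_sup => //; exists x].
split=> [N|]; first by rewrite ltr_wpDl ?harmonic_gt0.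
rewrite -(addr0 0); apply: cvgD; last exact: cvg_harmonic.
apply/cvgr0Pnorm_le => d d0; near=> N; rewrite ger0_norm//.
have [->|A0] := eqVneq A set0; first by rewrite image_set0 sup0 ltW.
apply: ge_sup; first by case/set0P: A0 => x Ax; exists (q N x), x.
by move=> _ [x Ax <-]; move: x Ax; near: N; exact: qle.
Unshelve. all: by end_near. Qed.

End Compacta.

(** * The fundamental system *)

Theorem proposition3p2 (R : realType) (X : completeNormedModType R[i])
    (e : nat -> X) (he : schauder_basis e) (hu : unconditional1 e) :
  [/\ forall eta : nat -> R, c0_pos R eta ->
        [/\ compact (K_ e eta), absolutely_convex (K_ e eta) & solid e (K_ e eta)],
      forall A : set X, compact A ->
        exists2 eta : nat -> R, c0_pos R eta & A `<=` K_ e eta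
    & forall (eta : nat -> R) (r : R), c0_pos R eta -> 0 < r ->
        [set r%:C *: x | x in K_ e eta] = K_ e (fun N => r * eta N)].
Proof.
split=> [eta etaP|A|eta r etaP]; last exact: K_scale.
- split; [exact: K_compact| |exact: K_solid].
  by apply: K_absolutely_convex => // N; case: etaP => + _ => /(_ N)/ltW.
- exact: compact_sub_K.
Qed.
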